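(* The orthoscheme complex of any bounded graded modular complemented lattice is CAT(0).
   Context: A poset is bounded if it has a minimum $0$ and a maximum $1$. A bounded poset $P$ has rank $m$ if every chain is contained in a maximal chain with $m+1$ elements; $P$ is graded if every interval $\{z: x\le z\le y\}$ has a (finite) rank. A lattice $P$ is modular if for all $x,y,z\in P$, $x\ge z$ implies $x\wedge(y\vee z)=(x\wedge y)\vee z$. A bounded lattice $P$ is complemented if for every $x\in P$ there is $y\in P$ with $x\wedge y=0$ and $x\vee y=1$. For a bounded graded poset $P$ of rank $m$, the orthoscheme complex $|P|$ is the simplicial complex with vertex set $P$ whose $k$-simplices are the chains $x_0<\dots<x_k$, where the simplex of each maximal chain $x_0<\dots<x_m$ is given the Euclidean metric of the convex hull in $\mathbb{R}^m$ of the points $(1,\dots,1,0,\dots,0)$ ($i$ ones, corresponding to $x_i$), and the whole complex carries the induced length metric. *)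

(* Defs.v *)
From mathcomp Require Import all_boot all_order all_algebra.
From mathcomp Require Import all_classical all_reals.
Set Implicit Arguments.
Unset Strict Implicit.
Unset Printing Implicit Defensive.
Import Order.TTheory GRing.Theory Num.Theory.
Local Open Scope classical_set_scope.
Local Open Scope ring_scope.

Section Posets.
Context {disp : Order.disp_t}.

Definition chain {T : porderType disp} (C : set T) : Prop :=
  total_on C (fun x y => (x <= y)%O).

Definition maximal_chain {T : porderType disp} (S M : set T) : Prop :=
  [/\ M `<=` S, chain M &
      forall C : set T, C `<=` S -> chain C -> M `<=` C -> C = M].

Definition has_rank {T : porderType disp} (S : set T) (m : nat) : Prop :=
  forall C : set T, C `<=` S -> chain C ->
    exists M : set T, [/\ maximal_chain S M, C `<=` M & (M #= `I_m.+1)%card].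

(* Only the intervals with x <= y are considered: the others are empty and
   have no rank.  For a bounded T, the whole of T is one of these intervals. *)
Definition graded (T : porderType disp) : Prop :=
  forall x y : T, (x <= y)%O ->
    exists m : nat, has_rank [set z : T | (x <= z <= y)%O] m.

Definition modular (L : latticeType disp) : Prop :=
  forall x y z : L, (z <= x)%O -> (x `&` (y `|` z) = (x `&` y) `|` z)%O.

Definition complemented (L : tbLatticeType disp) : Prop :=
  forall x : L, exists y : L, (x `&` y = \bot)%O /\ (x `|` y = \top)%O.

End Posets.

(* The norm that the library puts on row vectors is the sup norm, hence this
   explicit Euclidean distance. *)
Definition eucl_dist {R : realType} {n : nat} (u v : 'rV[R]_n) : R :=
  Num.sqrt (\sum_(i < n) (u ord0 i - v ord0 i) ^+ 2).

Section CAT0.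
Context {R : realType} {X : Type}.
Variable d : X -> X -> R.

Definition is_metric : Prop :=
  [/\ forall x y, 0 <= d x y,
      forall x y, d x y = 0 <-> x = y,
      forall x y, d x y = d y x &
      forall x y z, d x z <= d x y + d y z].

(* Geodesics are parametrised by arc length on [0, d x y]; the values of g
   outside this interval are irrelevant. *)
Definition is_geodesic (x y : X) (g : R -> X) : Prop :=
  [/\ g 0 = x, g (d x y) = y &
      forall s t, 0 <= s <= d x y -> 0 <= t <= d x y ->
        d (g s) (g t) = `|s - t|].

(* The vertices of a geodesic triangle are v 0, v 1, v 2, and its side g i
   goes from v i to v (i + 1), indices being taken modulo 3.  The point of the
   segment [w i, w (i + 1)] given below is the comparison point of g i s: when
   w is a comparison triangle, it lies at distance s from w i. *)
Definition comparison_point (v : 'I_3 -> X) (w : 'I_3 -> 'rV[R]_2)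
    (i : 'I_3) (s : R) : 'rV[R]_2 :=
  w i + (s / d (v i) (v (i + 1))) *: (w (i + 1) - w i).

Definition CAT0_inequality : Prop :=
  forall (v : 'I_3 -> X) (g : 'I_3 -> R -> X) (w : 'I_3 -> 'rV[R]_2),
    (forall i, is_geodesic (v i) (v (i + 1)) (g i)) ->
    (forall i j, eucl_dist (w i) (w j) = d (v i) (v j)) ->
    forall (i j : 'I_3) (s t : R),
      0 <= s <= d (v i) (v (i + 1)) -> 0 <= t <= d (v j) (v (j + 1)) ->
      d (g i s) (g j t) <=
        eucl_dist (comparison_point v w i s) (comparison_point v w j t).

Definition CAT0 : Prop :=
  [/\ is_metric,
      forall x y, exists g, is_geodesic x y g &
      CAT0_inequality].

End CAT0.

Section Orthoscheme.
Context (R : realType) {disp : Order.disp_t} (P : porderType disp).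

(* Points of the geometric realisation, in barycentric coordinates. *)
Record orthoscheme := Orthoscheme {
  bary :> P -> R;
  bary_ge0 : forall x, 0 <= bary x;
  bary_finite : finite_set [set x | bary x != 0];
  bary_chain : chain [set x | bary x != 0];
  bary_sum1 : \sum_(x \in [set: P]) bary x = 1
}.

(* c enumerates a maximal chain c 0 < ... < c n of P; if P has rank m, then
   n is necessarily m. *)
Definition maximal_chain_enum (n : nat) (c : 'I_n.+1 -> P) : Prop :=
  (forall i j : 'I_n.+1, (i < j)%N -> (c i < c j)%O) /\
  maximal_chain [set: P] (range c).

Definition in_simplex (n : nat) (c : 'I_n.+1 -> P) (p : orthoscheme) : Prop :=
  [set x | p x != 0] `<=` range c.

(* (1, ..., 1, 0, ..., 0) with i ones *)
Definition orthoscheme_vertex (n : nat) (i : 'I_n.+1) : 'rV[R]_n :=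
  \row_(j < n) (j < i)%N%:R.

Definition simplex_embedding (n : nat) (c : 'I_n.+1 -> P) (p : orthoscheme) :
    'rV[R]_n :=
  \sum_(i < n.+1) p (c i) *: orthoscheme_vertex i.

Definition simplex_dist (n : nat) (c : 'I_n.+1 -> P) (p q : orthoscheme) : R :=
  eucl_dist (simplex_embedding c p) (simplex_embedding c q).

(* polygonal_path p q l: there is a path of length l from p to q which is a
   concatenation of straight segments, each in the simplex of a maximal chain. *)
Inductive polygonal_path : orthoscheme -> orthoscheme -> R -> Prop :=
| polygonal_nil p : polygonal_path p p 0
| polygonal_cons n (c : 'I_n.+1 -> P) p q r l :
    maximal_chain_enum c -> in_simplex c p -> in_simplex c q ->
    polygonal_path q r l ->
    polygonal_path p r (simplex_dist c p q + l).

(* The length metric on the complex.  If P is bounded and graded, then the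
   set is nonempty: the simplices of maximal chains all share the vertex
   \bot. *)
Definition orthoscheme_dist (p q : orthoscheme) : R :=
  inf [set l | polygonal_path p q l].

End Orthoscheme.

(* Main.v *)
Require Import Defs.
From mathcomp Require Import all_boot all_order all_algebra.
From mathcomp Require Import all_classical all_reals.
From mathcomp Require Import zify ring lra.
Set Implicit Arguments.
Unset Strict Implicit.
Unset Printing Implicit Defensive.
Import Order.TTheory GRing.Theory Num.Theory.
Local Open Scope classical_set_scope.
Local Open Scope ring_scope.

(** Two flags [c] and [e] of a modular lattice generate a distributive
    sublattice, whose complex is isometric to a polytope, namely the monotone
    vectors in a cube (an apartment). The Euclidean geometry of these polytopes
    controls the whole complex, for the following reason.

    Regard points as probability measures on chains, and let the scalar product
    of two points be the mean rank of the meet of independent samples. In one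
    simplex it is the Euclidean scalar product, so the squared distance [dist2]
    that it defines there is the correct one. Fix a flag [z]. The steps
    [rank (x /\ z k) < rank (x /\ z k.+1)] crossed by [x] form a 0-1 vector, and
    their means over a point are its coordinates [coord z]. By supermodularity
    of [x |-> rank (x /\ y)] this map to Euclidean space shrinks [dist2]
    ([dist2_ge]), while it preserves distances to the points of the simplex of
    [z] ([dist2_eq]): it is the retraction of a building onto an apartment.

    Given [p] and [q], choose flags through them. In the apartment of these
    flags [dist2] is Euclidean ([rep_dist2]), so there is a straight segment
    from [p] to [q]. For a point [g] of it at time [t] take a flag [z] of the
    apartment whose simplex contains [g]. For any [f], the retraction centred at
    [z] keeps the distances from [g] to [f], [p] and [q], keeps the distance
    from [p] to [q], and decreases those from [f] to [p] and to [q]. Therefore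
    the Euclidean identity for [f], [p], [q] and the point dividing a segment
    becomes the CN inequality ([rep_mix_CN])
<<
      dist2 f g <= (1 - t) dist2 f p + t dist2 f q - t (1 - t) dist2 p q.
>>
    It implies the triangle inequality for the square root of [dist2]
    ([sqrt_dist2_triangle]), hence that polygonal paths from [p] to [q] are at
    least that long; the segment, cut at the walls that it crosses, is a
    polygonal path of exactly that length ([rep_polygonal]). So the square root
    of [dist2] is the length metric ([orthoscheme_distE]), and the CN inequality
    along one geodesic for each pair of points gives CAT(0) ([CN_CAT0]). *)

(** * The rank function of a modular lattice *)

Section MaximalChains.
Context {disp : Order.disp_t} {L : tbLatticeType disp}.

(** Otherwise the chain could be enlarged by [y]. *)
Lemma maximal_chain_mem (M : set L) (y : L) :
  maximal_chain [set: L] M ->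
  (forall x, M x -> (x <= y)%O \/ (y <= x)%O) -> M y.
Proof.
move=> [_ chM maxM] cmp; suff <- : M `|` [set y] = M by right.
apply: maxM => // a b [Ma|->] [Mb|->].
- exact: chM.
- exact: cmp.
- by have [] := cmp _ Mb; [right|left].
- by left.
Qed.

Lemma maximal_chain_enumerate (M : set L) m :
  maximal_chain [set: L] M -> (M #= `I_m.+1)%card ->
  exists2 c : 'I_m.+1 -> L, maximal_chain_enum c & range c = M.
Proof.
move=> maxM cardM; have [_ chM _] := maxM.
have finM : finite_set M by exists m.+1.
have [s0 Ms0] := (finite_seqP M).1 finM; pose s := sort <=%O (undup s0).
have Ms x : M x <-> x \in s by rewrite mem_sort mem_undup Ms0.
have sorted_s : sorted <%O s.
  rewrite lt_sorted_uniq_le sort_uniq undup_uniq /=.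
  apply: (@sort_sorted_in _ (mem (undup s0))); last exact/allP.
  by move=> x y; rewrite !mem_undup => xs ys; apply/orP/chM; rewrite Ms0.
have size_s : size s = m.+1.
  have us : uniq s by rewrite sort_uniq undup_uniq.
  apply/card_eq_II; apply: card_eq_trans cardM; rewrite card_eq_sym.
  have -> : M = [set nth \bot%O s i | i in `I_(size s)].
    apply/seteqP; split=> [x /Ms xs|_ [i /= lt_i <-]]; last exact/Ms/mem_nth.
    by exists (index x s); rewrite /= ?index_mem ?nth_index.
  apply: inj_card_eq => i j /[!inE] /= lt_i lt_j /eqP.
  by rewrite nth_uniq // => /eqP.
have ran : range (fun i : 'I_m.+1 => nth \bot%O s i) = M.
  apply/seteqP; split=> [_ [i _ <-]|x /Ms xs].
    by apply/Ms/mem_nth; rewrite size_s.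
  have lt_x : (index x s < m.+1)%N by rewrite -size_s index_mem.
  by exists (Ordinal lt_x) => //=; rewrite nth_index.
exists (fun i : 'I_m.+1 => nth \bot%O s i) => //; split; last by rewrite ran.
move=> i j lt_ij; apply: (sorted_ltn_nth lt_trans \bot%O sorted_s) => //;
  by rewrite inE size_s.
Qed.

Lemma graded_chain_sub : graded L ->
  exists m, forall C : set L, chain C ->
    exists2 c : 'I_m.+1 -> L, maximal_chain_enum c & C `<=` range c.
Proof.
move=> /(_ \bot%O \top%O (le0x _)) [m].
have -> : [set z : L | (\bot <= z <= \top)%O] = [set: L].
  by apply/seteqP; split=> // z _ /=; rewrite le0x lex1.
move=> hm; exists m => C chC; have [M [maxM CM cardM]] := hm C (fun _ _ => I) chC.
by have [c cmax cM] := maximal_chain_enumerate maxM cardM; exists c; rewrite ?cM.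
Qed.

(** Maximality of a finite chain in local form, on which ranks can be computed
    by induction along the chain. *)
Definition cover_chain (m : nat) (c : nat -> L) : Prop :=
  [/\ c 0%N = \bot%O, c m = \top%O &
      forall k, (k < m)%N -> (c k < c k.+1)%O /\
        forall y, (c k <= y <= c k.+1)%O -> y = c k \/ y = c k.+1].

Lemma maximal_chain_cover n (c : 'I_n.+1 -> L) :
  maximal_chain_enum c -> cover_chain n (fun k => c (inord k)).
Proof.
move=> [mono maxc].
have le_c (i j : 'I_n.+1) : (i <= j)%N -> (c i <= c j)%O.
  by rewrite leq_eqVlt => /orP[/eqP/val_inj->//|/mono/ltW].
split.
- have [i _ ci] : range c \bot%O.
    by apply: maximal_chain_mem => // x _; right; rewrite le0x.
  by apply/eqP; rewrite -lex0 -ci le_c // inordK.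
- have [i _ ci] : range c \top%O.
    by apply: maximal_chain_mem => // x _; left; rewrite lex1.
  by apply/eqP; rewrite -le1x -ci le_c // inordK // -ltnS ltn_ord.
- move=> k lt_kn; split; first by apply: mono; rewrite !inordK // ltnW.
  move=> y /andP[ky yk].
  have [i _ ci] : range c y.
    apply: maximal_chain_mem => // _ [i _ <-].
    have [le_ik|lt_ki] := leqP i k.
      by left; rewrite (le_trans _ ky) // le_c // inordK // ltnW.
    by right; rewrite (le_trans yk) // le_c // inordK.
  have [le_ik|lt_ki] := leqP i k; [left|right]; apply/eqP.
    by rewrite eq_le ky -ci le_c // inordK // ltnW.
  by rewrite eq_le yk -ci le_c // inordK.
Qed.

End MaximalChains.

Section Rank.
Context {disp : Order.disp_t} {L : tbLatticeType disp}.
Implicit Types x y z : L.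

(** These properties characterise the height function of a modular lattice of
    finite height; the lattice enters the geometry only through them. *)
Record is_rank (r : L -> nat) : Prop := IsRank {
  rank0 : r \bot%O = 0%N;
  rank_lt : forall x y, (x < y)%O -> (r x < r y)%N;
  rank_cover : forall x y, (x < y)%O ->
    (forall z, (x <= z <= y)%O -> z = x \/ z = y) -> r y = (r x).+1;
  rank_modular : forall x y, (r (x `&` y)%O + r (x `|` y)%O = r x + r y)%N
}.

Section Existence.
Hypothesis Lmod : modular L.
Variables (m : nat) (c : nat -> L).
Hypothesis cC : cover_chain m c.

(** The number of steps of the maximal chain [c] that [x] crosses. Measuring
    all elements against one fixed chain gives the height without comparing the
    lengths of different maximal chains. *)
Definition chain_rank (x : L) : nat :=
  \sum_(k < m) (c k.+1 <= c k `|` x)%O.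

Let c_lt k : (k < m)%N -> (c k < c k.+1)%O.
Proof. by have [_ _ h] := cC => /h[]. Qed.

Let c_cover k y : (k < m)%N -> (c k <= y <= c k.+1)%O -> y = c k \/ y = c k.+1.
Proof. by have [_ _ h] := cC => /h[_]; apply. Qed.

Let jump_le x y k : (x <= y)%O ->
  ((c k.+1 <= c k `|` x)%O <= (c k.+1 <= c k `|` y)%O)%N.
Proof.
move=> xy; case: (boolP (_ <= c k `|` x)%O) => // h.
by rewrite (le_trans h) // leU2.
Qed.

Let chain_rank_le x y : (x <= y)%O -> (chain_rank x <= chain_rank y)%N.
Proof. by move=> xy; apply: leq_sum => k _; exact: jump_le. Qed.

(** If both indicators agree then [x] and [y] have the same meet and the same
    join with [c k] below [c k.+1], and modularity identifies them there. *)
Let jump_eq x y k : (k < m)%N -> (x <= y)%O -> (x `&` c k = y `&` c k)%O ->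
  (c k.+1 <= c k `|` x)%O = (c k.+1 <= c k `|` y)%O ->
  (x `&` c k.+1 = y `&` c k.+1)%O.
Proof.
move=> km xy exy.
have ck := ltW (c_lt km).
have joinE z : (c k `|` (z `&` c k.+1) = c k.+1 `&` (z `|` c k))%O.
  by rewrite (Lmod _ ck) joinC [(z `&` _)%O]meetC.
have cov z : (c k.+1 `&` (z `|` c k) = if c k.+1 <= c k `|` z then c k.+1 else c k)%O.
  case: ifP => [h|h]; first by apply/eqP; rewrite eq_meetl joinC.
  have /(c_cover km)[//|e] : (c k <= c k.+1 `&` (z `|` c k) <= c k.+1)%O.
    by rewrite lexI ck leUr leIl.
  by move: h; rewrite joinC leEmeet e eqxx.
move=> eJ.
have eJ' : (c k `|` (x `&` c k.+1) = c k `|` (y `&` c k.+1))%O.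
  by rewrite !joinE !cov eJ.
have le_xy : (x `&` c k.+1 <= y `&` c k.+1)%O by rewrite leI2.
have := @Lmod (y `&` c k.+1)%O (c k) (x `&` c k.+1)%O le_xy.
rewrite eJ' -[(y `&` _ `&` c k)%O]meetA (meet_r ck) -exy.
have -> : (y `&` c k.+1 `&` (c k `|` y `&` c k.+1) = y `&` c k.+1)%O.
  by apply/eqP; rewrite eq_meetl leUr.
by move=> ->; apply/esym/eqP; rewrite eq_joinr leI2.
Qed.

Let meet_first_diff x y k : (k <= m)%N -> (x <= y)%O ->
  (forall i, (i < k)%N ->
    (c i.+1 <= c i `|` x)%O = (c i.+1 <= c i `|` y)%O) ->
  (x `&` c k = y `&` c k)%O.
Proof.
move=> + xy; elim: k => [|k IHk] km h.
  by have [-> _ _] := cC; rewrite !meetx0.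
apply: jump_eq => //; last exact: h.
by apply: IHk => [|i ik]; [exact: ltnW|apply/h/ltnW].
Qed.

Let rank_le_eq x y : (x <= y)%O -> chain_rank x = chain_rank y -> x = y.
Proof.
move=> xy e; have [_ cm _] := cC; have := subnn (chain_rank x).
rewrite {1}e -sumnB => [/eqP|k _]; last exact: jump_le.
rewrite sum_nat_eq0 => /forallP h.
have := @meet_first_diff x y m (leqnn _) xy; rewrite cm !meetx1; apply=> i im.
have := h (Ordinal im); have := jump_le (Ordinal im) xy.
by rewrite /=; do 2 case: (_ <= _)%O.
Qed.

Let chain_rank_lt x y : (x < y)%O -> (chain_rank x < chain_rank y)%N.
Proof.
move=> xy; rewrite ltn_neqAle chain_rank_le ?ltW // andbT.
by apply/eqP => /(rank_le_eq (ltW xy)) e; rewrite e ltxx in xy.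
Qed.

(** Along a cover [x < y] the count changes at one step only: at the first
    [k] where [x] and [y] have different traces below [c k.+1], since [y] is
    then the join of [x] with its own trace, which later [c i] absorb. *)
Let chain_rank_cover x y : (x < y)%O ->
  (forall z, (x <= z <= y)%O -> z = x \/ z = y) ->
  chain_rank y = (chain_rank x).+1.
Proof.
move=> xy cov.
pose b z i := (c i.+1 <= c i `|` z)%O.
have [i bi] : exists i : 'I_m, b x i != b y i.
  apply/existsP; rewrite -negb_forall; apply/negP => /forallP h.
  suff e : chain_rank x = chain_rank y.
    by have := chain_rank_lt xy; rewrite e ltnn.
  by apply: eq_bigr => i _; congr nat_of_bool; exact/eqP/h.
have [k /andP[km bk] kmin] := ex_minnP
  (ex_intro (fun k => (k < m)%N && (b x k != b y k)) i (introT andP (conj (ltn_ord i) bi))).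
have ck := ltW (c_lt km).
have bE z : b z k = (c k.+1 <= c k `|` (z `&` c k.+1))%O.
  by rewrite [(z `&` _)%O]meetC joinC -(Lmod _ ck) lexI lexx /b joinC.
have [xk yk] : b x k = false /\ b y k.
  by move: bk (jump_le k (ltW xy)); rewrite -/(b x k) -/(b y k); do 2 case: (b _ _).
have yE : (y = x `|` (y `&` c k.+1))%O.
  have [||//] := cov (x `|` (y `&` c k.+1))%O; rewrite ?leUl ?leUx ?leIl ?(ltW xy) //.
  move=> e; have le : (y `&` c k.+1 <= x)%O by rewrite -e leUr.
  move: xk; rewrite bE => /negP[]; move: yk; rewrite bE => /le_trans; apply.
  by rewrite leU2 // lexI le leIr.
have le_c : {in [pred i | (i <= m)%N] &, {homo c : i j / (i <= j)%N >-> (i <= j)%O}}.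
  move=> i1 j1; rewrite !inE => _ + le_ij; elim: j1 le_ij => [|j1 IHj].
    by rewrite leqn0 => /eqP->.
  rewrite leq_eqVlt => /orP[/eqP->//|le_ij] jm.
  by rewrite (le_trans (IHj le_ij (ltnW jm))) // ltW // c_lt.
rewrite /chain_rank (bigD1 (Ordinal km)) //= [in RHS](bigD1 (Ordinal km)) //=.
rewrite -/(b x k) -/(b y k) xk yk add1n add0n; congr _.+1.
apply: eq_bigr => j /eqP jk; congr nat_of_bool.
have [ltjk|ltkj|ejk] := ltngtP j k; last by case: jk; exact: val_inj.
  apply/eqP; rewrite eq_sym; apply: contraTT ltjk => h; rewrite -leqNgt.
  by apply: kmin; rewrite ltn_ord.
have kj : (y `&` c k.+1 <= c j)%O.
  by rewrite (le_trans (leIr _ _)) // le_c // inE ltnW.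
by rewrite [in LHS]yE [(x `|` _)%O]joinC joinA (join_l kj).
Qed.

(** Ranks being bounded, an element of maximal rank below [y] is a lower cover. *)
Let rank_cover_below x y : (x < y)%O -> exists z, [/\ (x <= z)%O, (z < y)%O &
  forall t, (z <= t <= y)%O -> t = z \/ t = y].
Proof.
move=> xy.
pose P n := `[< exists z, [/\ (x <= z)%O, (z < y)%O & chain_rank z = n] >].
have exP : exists n, P n by exists (chain_rank x); apply/asboolP; exists x.
have ubP n : P n -> (n <= chain_rank y)%N.
  by move=> /asboolP[z [_ zy <-]]; rewrite chain_rank_le // ltW.
have [n /asboolP[z [xz zy zn]] nmax] := ex_maxnP exP ubP.
exists z; split=> // t /andP[zt ty]; move: zt; rewrite le_eqVlt => /orP[/eqP->|zt].
  by left.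
move: ty; rewrite le_eqVlt => /orP[/eqP->|ty]; first by right.
have : P (chain_rank t).
  by apply/asboolP; exists t; split=> //; exact: le_trans xz (ltW zt).
by move=> /nmax; rewrite -zn leqNgt chain_rank_lt.
Qed.

(** Going down from [x] to [x `&` y] along covers, each of them is transported
    by [_ `|` y] to a cover, by the diamond isomorphism of modular lattices. *)
Let chain_rank_modular x y :
  (chain_rank (x `&` y)%O + chain_rank (x `|` y)%O = chain_rank x + chain_rank y)%N.
Proof.
have [n] := ubnP (chain_rank x); elim: n x => // n IHn x.
rewrite ltnS => xn.
have : (x `&` y <= x)%O by rewrite leIl.
rewrite le_eqVlt => /orP[/eqP e|lt].
  by rewrite e; congr (_ + chain_rank _)%N; apply: join_r; rewrite -e leIr.
have [z [xz zx zcov]] := rank_cover_below lt.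
have zy : (z `&` y = x `&` y)%O.
  by apply/eqP; rewrite eq_le leI2 ?(ltW zx) //= lexI xz leIr.
have xzy : (x `&` (z `|` y) = z)%O.
  by rewrite joinC (Lmod _ (ltW zx)); apply: join_r.
have := IHn z (leq_trans (chain_rank_lt zx) xn).
rewrite (chain_rank_cover zx zcov) zy.
suff -> : chain_rank (x `|` y)%O = (chain_rank (z `|` y)%O).+1 by lia.
apply: chain_rank_cover.
  rewrite lt_neqAle leU2 ?(ltW zx) // andbT; apply/eqP => e.
  by move: xzy; rewrite e joinKI => e'; rewrite e' ltxx in zx.
move=> t /andP[zt tx].
have yt : (y <= t)%O by rewrite (le_trans _ zt) ?leUr.
have tE : (t = (t `&` x) `|` y)%O by rewrite -(Lmod _ yt); apply/esym/meet_l.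
have [] := zcov (t `&` x)%O.
- by rewrite leIr lexI (ltW zx) (le_trans _ zt) ?leUl.
- by move=> e; left; rewrite tE e.
- by move=> e; right; rewrite tE e.
Qed.

Lemma chain_rankP : is_rank chain_rank.
Proof.
split; [|exact: chain_rank_lt|exact: chain_rank_cover|exact: chain_rank_modular].
have [c0 _ _] := cC; rewrite /chain_rank big1 // => k _; rewrite joinx0.
by have := c_lt (ltn_ord k); rewrite lt_leAnge => /andP[_ /negPf->].
Qed.

End Existence.

Lemma rank_exists : graded L -> modular L -> exists r, is_rank r.
Proof.
move=> /graded_chain_sub[m hm] Lmod.
have [|c cmax _] := hm set0; first by [].
exists (chain_rank m (fun k => c (inord k))).
by apply: chain_rankP => //; exact: maximal_chain_cover.
Qed.

End Rank.

(** * Flags and the steps that an element crosses *)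

Section Flags.
Context {disp : Order.disp_t} {L : tbLatticeType disp}.
Variable r : L -> nat.
Hypothesis rk : is_rank r.
Implicit Types x y : L.

Local Notation m := (r \top%O).

Lemma rank_le x y : (x <= y)%O -> (r x <= r y)%N.
Proof. by rewrite le_eqVlt => /orP[/eqP->//|/(rank_lt rk)/ltnW]. Qed.

Lemma rank_le_eq x y : (x <= y)%O -> (r y <= r x)%N -> x = y.
Proof.
by rewrite le_eqVlt => /orP[/eqP->//|/(rank_lt rk)]; rewrite ltnNge => /negPf->.
Qed.

Lemma rank_le_top x : (r x <= m)%N.
Proof. by rewrite rank_le ?lex1. Qed.

(** A maximal chain, indexed by the rank of its elements and prolonged by the
    top, so that its indices need no bound. *)
Definition flag (z : nat -> L) : Prop :=
  {homo z : i j / (i <= j)%N >-> (i <= j)%O} /\ forall k, r (z k) = minn k m.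

Lemma flag_meet z i j : flag z -> (z i `&` z j = z (minn i j))%O.
Proof.
move=> [homz _]; case: leqP => [le_ij|/ltnW le_ji].
  exact/meet_l/homz.
exact/meet_r/homz.
Qed.

Lemma flag0 z : flag z -> z 0%N = \bot%O.
Proof.
move=> [_ rz]; apply/esym/rank_le_eq; rewrite ?le0x //.
by rewrite rz min0n.
Qed.

Lemma flag_top z k : flag z -> (m <= k)%N -> z k = \top%O.
Proof.
by move=> [_ rz] mk; apply/rank_le_eq; rewrite ?lex1 // rz (minn_idPr mk).
Qed.

Lemma flag_rank_le z k : flag z -> (k <= m)%N -> r (z k) = k.
Proof. by move=> [_ rz] km; rewrite rz (minn_idPl km). Qed.

Lemma flag_of_enum n (c : 'I_n.+1 -> L) : maximal_chain_enum c ->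
  n = m /\ exists2 z, flag z & forall i : 'I_n.+1, c i = z i.
Proof.
move=> cmax; have [c0 cn cov] := maximal_chain_cover cmax.
have rc k : (k <= n)%N -> r (c (inord k)) = k.
  elim: k => [|k IHk] kn; first by rewrite c0 (rank0 rk).
  by have [lt_k /(rank_cover rk lt_k)->] := cov k kn; rewrite IHk // ltnW.
have nm : n = m by rewrite -cn rc.
split=> //; exists (fun k => c (inord (minn k n))) => [|i]; last first.
  by rewrite (minn_idPl _) ?inord_val // -ltnS ltn_ord.
split=> [i j le_ij|k]; last by rewrite rc ?geq_minr // {1}nm.
have : (minn i n <= minn j n)%N by rewrite leq_min geq_minr geq_min le_ij.
rewrite leq_eqVlt => /orP[/eqP->//|lt_ij]; apply/ltW/(proj1 cmax).
by rewrite !inordK // ltnS geq_minr.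
Qed.

Lemma enum_of_flag z : flag z -> maximal_chain_enum (fun i : 'I_m.+1 => z i).
Proof.
move=> fz; have [homz rz] := fz; split.
  move=> i j lt_ij; rewrite lt_neqAle homz ?(ltnW lt_ij) // andbT.
  apply/eqP => /(congr1 r); rewrite !(flag_rank_le fz) -1?ltnS ?ltn_ord // => e.
  by rewrite e ltnn in lt_ij.
split=> // [_ _ [i _ <-] [j _ <-]|C _ chC ranC].
  by have [/homz|/ltnW/homz] := leqP i j; [left|right].
apply/seteqP; split=> // x Cx; have lt_x : (r x < m.+1)%N by rewrite ltnS rank_le_top.
exists (Ordinal lt_x) => //=.
have Cz : C (z (r x)) by apply: ranC; exists (Ordinal lt_x).
have rzx : r (z (r x)) = r x by rewrite flag_rank_le // rank_le_top.
have [le|le] := chC _ _ Cx Cz; last by apply: rank_le_eq; rewrite ?rzx.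
by apply/esym/rank_le_eq; rewrite ?rzx.
Qed.

Lemma chain_in_flag : graded L -> forall C : set L, chain C ->
  exists2 z, flag z & forall x, C x -> z (r x) = x.
Proof.
move=> /graded_chain_sub[n hn] C /hn[c /flag_of_enum[nm [z fz zc]] Cc].
exists z => // x /Cc[i _ <-]; rewrite zc flag_rank_le //.
by rewrite -nm -ltnS ltn_ord.
Qed.

(** The jumps of [k |-> r (x /\ z k)]; they are the coordinates of [x] in the
    retraction onto an apartment centred at the flag [z]. *)
Definition step (z : nat -> L) (k : nat) (x : L) : bool :=
  (r (x `&` z k)%O < r (x `&` z k.+1)%O)%N.

(** The rank grows by at most one along a flag, and meeting with [x] cannot
    make it grow faster. *)
Lemma step_rank z k x : flag z ->
  r (x `&` z k.+1)%O = (r (x `&` z k)%O + step z k x)%N.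
Proof.
move=> [homz rz]; have zk : (z k <= z k.+1)%O by exact: homz.
have := rank_modular rk (x `&` z k.+1)%O (z k).
rewrite -meetA (meet_r zk) /step.
have : (r (x `&` z k)%O <= r (x `&` z k.+1)%O)%N by rewrite rank_le // leI2.
have : (r ((x `&` z k.+1) `|` z k)%O <= r (z k.+1))%N.
  by rewrite rank_le // leUx leIr.
rewrite !rz; case: ltnP; lia.
Qed.

Lemma step_sum z n x : flag z -> r (x `&` z n)%O = (\sum_(k < n) step z k x)%N.
Proof.
move=> fz; elim: n => [|n IHn]; last by rewrite big_ord_recr -IHn step_rank.
by rewrite big_ord0 flag0 // meetx0 (rank0 rk).
Qed.

Lemma step_sum_rank z x : flag z -> r x = (\sum_(k < m) step z k x)%N.
Proof. by move=> fz; rewrite -step_sum // flag_top // meetx1. Qed.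

(** Supermodularity of the rank of a meet: this is what makes retractions
    shrink distances. *)
Lemma step_le z k x y : flag z -> (x <= y)%O -> step z k x -> step z k y.
Proof.
move=> [homz _] xy; rewrite /step => stx; have zk : (z k <= z k.+1)%O by exact: homz.
have := rank_modular rk (y `&` z k)%O (x `&` z k.+1)%O.
have -> : ((y `&` z k) `&` (x `&` z k.+1) = x `&` z k)%O.
  by rewrite meetACA (meet_r xy) (meet_l zk).
have : (r ((y `&` z k) `|` (x `&` z k.+1))%O <= r (y `&` z k.+1)%O)%N.
  by rewrite rank_le // leUx !leI2.
lia.
Qed.

Lemma step_meet z k x y : flag z ->
  step z k (x `&` y)%O -> step z k x && step z k y.
Proof. by move=> fz st; rewrite !(step_le fz _ st) ?leIl ?leIr. Qed.

Lemma step_flag z k x : flag z -> z (r x) = x -> step z k x = (k < r x)%N.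
Proof.
move=> fz zx; have := rank_le_top x; rewrite /step -zx !flag_meet //.
by rewrite (proj2 fz) => h; rewrite !(proj2 fz); lia.
Qed.

End Flags.

(** * Points, scalar product and retractions *)

Section Points.
Context {R : realType} {disp : Order.disp_t} {L : tbLatticeType disp}.
Variable r : L -> nat.
Hypothesis rk : is_rank r.
Hypothesis Lgr : graded L.
Implicit Types (x y : L) (p q : orthoscheme R L) (z : nat -> L).

Local Notation m := (r \top%O).

Definition through z p : Prop := forall x, p x != 0 -> z (r x) = x.

Lemma ex_flag_through p : exists2 z, flag r z & through z p.
Proof. exact: (chain_in_flag rk Lgr (@bary_chain _ _ _ p)). Qed.

Lemma fsbig_flag z (g : L -> R) : flag r z ->
  (forall x, g x != 0 -> z (r x) = x) ->
  \sum_(x \in [set: L]) g x = \sum_(i < m.+1) g (z i).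
Proof.
move=> fz zg; pose s := [seq z i | i <- iota 0 m.+1].
have us : uniq s.
  rewrite map_inj_in_uniq ?iota_uniq // => i j.
  rewrite !mem_iota !add0n => /andP[_ im] /andP[_ jm] /(congr1 r).
  by rewrite !(flag_rank_le fz).
have -> : \sum_(i < m.+1) g (z i) = \sum_(x <- s) g x.
  by rewrite big_map -(big_mkord xpredT (fun i => g (z i))) /index_iota subn0.
rewrite [RHS](@fsbig_seq _ _ _ _ s g us); apply/esym.
apply: (@fsbig_widen _ _ _ _ [set` s] [set: L]) => // x [_ /= xs].
apply/eqP; apply: contrapT => /negP gx.
case: xs; rewrite /= -(zg _ gx); apply: map_f.
by rewrite mem_iota /= add0n ltnS rank_le_top.
Qed.

(** A point is a probability measure on a chain, and [expect p] integrates
    against it. *)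
Definition expect p (f : L -> R) : R := \sum_(x \in [set: L]) p x * f x.

Lemma expect_flag z p f : flag r z -> through z p ->
  expect p f = \sum_(i < m.+1) p (z i) * f (z i).
Proof.
move=> fz zp; apply: (fsbig_flag fz) => x pfx; apply: zp.
by apply: contraNneq pfx => ->; rewrite mul0r.
Qed.

Lemma expect_cst p a : expect p (fun=> a) = a.
Proof.
have [z fz zp] := ex_flag_through p.
rewrite -[RHS]mul1r -(bary_sum1 p) (expect_flag _ fz zp) -mulr_suml; congr (_ * _).
have := expect_flag (fun=> 1) fz zp; rewrite /expect.
under eq_fsbigr => x _ do rewrite mulr1.
by under [in RHS]eq_bigr => x _ do rewrite mulr1.
Qed.

Lemma eq_expect p f g : (forall x, p x != 0 -> f x = g x) ->
  expect p f = expect p g.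
Proof.
move=> fg; apply: eq_fsbigr => x _.
by have [->|/fg->//] := eqVneq (p x) 0; rewrite !mul0r.
Qed.

Lemma expect_le p f g : (forall x, p x != 0 -> f x <= g x) ->
  expect p f <= expect p g.
Proof.
move=> fg; have [z fz zp] := ex_flag_through p; rewrite !(expect_flag _ fz zp).
apply: ler_sum => i _; have [->|/fg fgi] := eqVneq (p (z i)) 0.
  by rewrite !mul0r.
by rewrite ler_wpM2l ?bary_ge0.
Qed.

Lemma expectZl p a f : expect p (fun x => a * f x) = a * expect p f.
Proof.
have [z fz zp] := ex_flag_through p; rewrite !(expect_flag _ fz zp) mulr_sumr.
by apply: eq_bigr => i _; rewrite mulrCA.
Qed.

Lemma expectZr p a f : expect p (fun x => f x * a) = expect p f * a.
Proof.
by rewrite mulrC -expectZl; apply: eq_expect => x _; rewrite mulrC.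
Qed.

Lemma expect_sum p n (F : 'I_n -> L -> R) :
  expect p (fun x => \sum_(k < n) F k x) = \sum_(k < n) expect p (F k).
Proof.
have [z fz zp] := ex_flag_through p; rewrite (expect_flag _ fz zp).
under [RHS]eq_bigr => k _ do rewrite (expect_flag _ fz zp).
rewrite exchange_big; apply: eq_bigr => i _.
by rewrite mulr_sumr.
Qed.

Lemma expect2_sum p q n (F G : 'I_n -> L -> R) :
  expect p (fun x => expect q (fun y => \sum_(k < n) F k x * G k y)) =
  \sum_(k < n) expect p (F k) * expect q (G k).
Proof.
under [RHS]eq_bigr => k _ do rewrite -expectZr.
rewrite -expect_sum; apply: eq_expect => x _.
by rewrite expect_sum; apply: eq_bigr => k _; rewrite expectZl.
Qed.

(** In a simplex the vertices of ranks [i] and [j] have the scalar product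
    [minn i j], the rank of their meet. Extended bilinearly, the rank of the
    meet gives a scalar product of any two points, and by polarisation a
    candidate for the squared distance in the whole complex. *)
Definition inner p q : R := expect p (fun x => expect q (fun y => (r (x `&` y)%O)%:R)).

Definition dist2 p q : R := inner p p + inner q q - 2 * inner p q.

Lemma inner_sym p q : inner p q = inner q p.
Proof.
have [z fz zp] := ex_flag_through p; have [t ft tq] := ex_flag_through q.
rewrite /inner (expect_flag _ fz zp) (expect_flag _ ft tq).
under eq_bigr => i _ do rewrite (expect_flag _ ft tq) mulr_sumr.
under [RHS]eq_bigr => i _ do rewrite (expect_flag _ fz zp) mulr_sumr.
rewrite exchange_big; apply: eq_bigr => i _; apply: eq_bigr => j _.
by rewrite mulrCA meetC.
Qed.

Lemma dist2_sym p q : dist2 p q = dist2 q p.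
Proof. by rewrite /dist2 (inner_sym p q); ring. Qed.

Lemma dist2_refl p : dist2 p p = 0.
Proof. by rewrite /dist2; ring. Qed.

(** The retraction of the complex onto Euclidean space that is centred at the
    simplex of [z]. *)
Definition coord z p (k : nat) : R := expect p (fun x => (step r z k x)%:R).

Lemma coord_flag z p k : flag r z -> through z p ->
  coord z p k = \sum_(i < m.+1) p (z i) * (k < i)%N%:R.
Proof.
move=> fz zp; rewrite /coord (expect_flag _ fz zp); apply: eq_bigr => i _.
have ri : r (z i) = i by rewrite flag_rank_le // -ltnS ltn_ord.
by rewrite step_flag // ri.
Qed.

Let rank_meet_sum z x y : flag r z ->
  (r (x `&` y)%O)%:R = \sum_(k < m) (step r z k (x `&` y)%O)%:R :> R.
Proof. by move=> fz; rewrite {1}(step_sum_rank rk _ fz) natr_sum. Qed.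

(** A step crossed by a meet is crossed by both elements. *)
Lemma inner_le z p q : flag r z ->
  inner p q <= \sum_(k < m) coord z p k * coord z q k.
Proof.
move=> fz; rewrite -expect2_sum; apply: expect_le => x _; apply: expect_le => y _.
rewrite (rank_meet_sum _ _ fz); apply: ler_sum => k _.
rewrite -natrM ler_nat mulnb; have := @step_meet _ _ _ rk z k x y fz.
by case: step => // ->.
Qed.

(** For [x] in the flag the converse holds too: a step that [x] crosses lies
    below [x], where meeting with [x] changes nothing. *)
Lemma inner_eq z p q : flag r z -> through z p ->
  inner p q = \sum_(k < m) coord z p k * coord z q k.
Proof.
move=> fz zp; rewrite -expect2_sum; apply: eq_expect => x px; apply: eq_expect => y _.
rewrite (rank_meet_sum _ _ fz); apply: eq_bigr => k _.
rewrite -natrM mulnb; congr (nat_of_bool _)%:R.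
apply/idP/idP => [|/andP[stx sty]]; first exact: step_meet.
move: stx sty; rewrite step_flag ?zp // => kx; rewrite /step.
rewrite [(x `&` y)%O]meetC -!meetA -(zp x px) !(flag_meet _ _ fz).
by rewrite (minn_idPr kx) (minn_idPr (ltnW kx)).
Qed.

(** The support of [p] is a chain, and the meet of two comparable elements is
    one of them. *)
Lemma inner_self z p : flag r z -> inner p p = \sum_(k < m) coord z p k ^+ 2.
Proof.
move=> fz; under [RHS]eq_bigr => k _ do rewrite expr2.
rewrite -expect2_sum; apply: eq_expect => x px; apply: eq_expect => y py.
rewrite (rank_meet_sum _ _ fz); apply: eq_bigr => k _.
rewrite -natrM mulnb; congr (nat_of_bool _)%:R.
have [xy|yx] := bary_chain px py.
  rewrite (meet_l xy); have := @step_le _ _ _ rk z k _ _ fz xy.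
  by case: (step r z k x) => // ->.
rewrite (meet_r yx); have := @step_le _ _ _ rk z k _ _ fz yx.
by case: (step r z k y); rewrite ?andbF // => ->.
Qed.

Let sum_sqrB n (a b : 'I_n -> R) : \sum_(k < n) (a k - b k) ^+ 2 =
  \sum_(k < n) a k ^+ 2 + \sum_(k < n) b k ^+ 2 - 2 * \sum_(k < n) a k * b k.
Proof.
rewrite mulr_sumr -sumrN -!big_split /=; apply: eq_bigr => k _; ring.
Qed.

(** The retraction preserves norms and does not decrease scalar products. *)
Lemma dist2_ge z p q : flag r z ->
  \sum_(k < m) (coord z p k - coord z q k) ^+ 2 <= dist2 p q.
Proof.
move=> fz; rewrite sum_sqrB /dist2 !(inner_self _ fz).
by have := inner_le p q fz; lra.
Qed.

Lemma dist2_eq z p q : flag r z -> through z p ->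
  dist2 p q = \sum_(k < m) (coord z p k - coord z q k) ^+ 2.
Proof.
by move=> fz zp; rewrite sum_sqrB /dist2 !(inner_self _ fz) (inner_eq _ fz zp).
Qed.

Lemma dist2_ge0 p q : 0 <= dist2 p q.
Proof.
have [z fz zp] := ex_flag_through p; rewrite (dist2_eq _ fz zp).
by apply: sumr_ge0 => k _; exact: sqr_ge0.
Qed.

Lemma ex_point z (l : nat -> R) : flag r z -> (forall k, 0 <= l k) ->
  \sum_(k < m.+1) l k = 1 ->
  exists2 p, through z p & forall k, (k <= m)%N -> p (z k) = l k.
Proof.
move=> fz l0 l1; pose f x := if z (r x) == x then l (r x) else 0.
have fz0 x : f x != 0 -> z (r x) = x by rewrite /f; case: ifP => [/eqP//|_]; rewrite eqxx.
have fE k : (k <= m)%N -> f (z k) = l k.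
  by move=> km; rewrite /f (flag_rank_le fz) // eqxx.
have f0 x : 0 <= f x by rewrite /f; case: ifP.
have ffin : finite_set [set x | f x != 0].
  apply: (@sub_finite_set _ _ (range (fun i : 'I_m.+1 => z i))).
    move=> x /fz0 zx; have lt_x : (r x < m.+1)%N by rewrite ltnS rank_le_top.
    by exists (Ordinal lt_x).
  by apply: finite_image; exact: finite_finset.
have fch : chain [set x | f x != 0].
  move=> x y /fz0 <- /fz0 <-; have [/(proj1 fz)|/ltnW/(proj1 fz)] := leqP (r x) (r y);
  by [left|right].
have f1 : \sum_(x \in [set: L]) f x = 1.
  rewrite (fsbig_flag fz fz0) -l1; apply: eq_bigr => i _.
  by rewrite fE // -ltnS ltn_ord.
by exists (Orthoscheme f0 ffin fch f1).
Qed.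

Lemma eq_orthoscheme p q : p =1 q -> p = q.
Proof.
case: p q => [p p0 pf pc p1] [q q0 qf qc q1] /= /funext e.
by case: q / e q0 qf qc q1 => *; congr Orthoscheme; exact: Prop_irrelevance.
Qed.

(** Within a simplex the barycentric coordinates are the successive
    differences of the coordinates. *)
Lemma coord_inj z p q : flag r z -> through z p -> through z q ->
  (forall k, (k < m)%N -> coord z p k = coord z q k) -> p = q.
Proof.
move=> fz zp zq e; apply: eq_orthoscheme => x.
have mass p' : through z p' -> \sum_(i < m.+1) p' (z i) = 1.
  move=> zp'; rewrite -[RHS](expect_cst p') (expect_flag _ fz zp').
  by apply: eq_bigr => i _; rewrite mulr1.
pose tail (p' : orthoscheme R L) k : R := \sum_(i < m.+1) p' (z i) * (k <= i)%N%:R.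
have tailE k : tail p k = tail q k.
  case: k => [|k]; rewrite /tail.
    under eq_bigr => i _ do rewrite leq0n mulr1.
    under [RHS]eq_bigr => i _ do rewrite leq0n mulr1.
    by rewrite !mass.
  rewrite -!coord_flag //; have [mk|] := leqP m k; last exact: e.
  rewrite !coord_flag // !big1 // => i _;
    by rewrite ltnNge (leq_trans _ mk) ?mulr0 // -ltnS ltn_ord.
have diff p' (i : 'I_m.+1) : p' (z i) = tail p' i - tail p' i.+1.
  rewrite /tail -sumrB (bigD1 i) //= leqnn ltnn mulr1 mulr0 subr0 big1 ?addr0 //.
  move=> j ji; rewrite leq_eqVlt; case: ltngtP => //=; rewrite ?subrr // => ij.
  by case/eqP: ji; apply/val_inj.
have lt_x : (r x < m.+1)%N by rewrite ltnS rank_le_top.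
have [zx|zx] := eqVneq (z (r x)) x.
  by rewrite -zx; have := diff^~ (Ordinal lt_x) => /= d; rewrite !d !tailE.
have out p' : through z p' -> p' x = 0.
  by move=> h; apply/eqP; apply: contraNT zx => /h/eqP.
by rewrite !out.
Qed.

Lemma simplex_embedding_coord z n (c : 'I_n.+1 -> L) p (j : 'I_n) :
  flag r z -> n = m -> (forall i, c i = z i) -> through z p ->
  simplex_embedding c p ord0 j = coord z p j.
Proof.
move=> fz nm; move: c j; rewrite nm => c j cz zp.
rewrite (coord_flag _ fz zp) /simplex_embedding summxE; apply: eq_bigr => i _.
by rewrite !mxE cz.
Qed.

Lemma simplex_dist_dist2 z n (c : 'I_n.+1 -> L) p q :
  flag r z -> n = m -> (forall i, c i = z i) -> through z p -> through z q ->
  simplex_dist c p q = Num.sqrt (dist2 p q).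
Proof.
move=> fz nm cz zp zq; rewrite /simplex_dist /eucl_dist (dist2_eq _ fz zp).
congr Num.sqrt; rewrite -nm; apply: eq_bigr => j _.
by rewrite !(simplex_embedding_coord j fz nm cz).
Qed.

Lemma simplex_dist_in_simplex n (c : 'I_n.+1 -> L) p q :
  maximal_chain_enum c -> in_simplex c p -> in_simplex c q ->
  simplex_dist c p q = Num.sqrt (dist2 p q).
Proof.
move=> /(flag_of_enum rk)[nm [z fz cz]] cp cq.
have thr p' : in_simplex c p' -> through z p'.
  move=> cp' x /cp'[i _ <-]; rewrite cz (flag_rank_le fz) //.
  by rewrite -nm -ltnS ltn_ord.
by apply: simplex_dist_dist2 fz nm cz _ _; exact: thr.
Qed.

Lemma polygonal_path_flag z p q : flag r z -> through z p -> through z q ->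
  polygonal_path p q (Num.sqrt (dist2 p q)).
Proof.
move=> fz zp zq; rewrite -[Num.sqrt _]addr0.
rewrite -(@simplex_dist_dist2 z m (fun i : 'I_m.+1 => z i)) //.
have ins p' : through z p' -> in_simplex (fun i : 'I_m.+1 => z i) p'.
  move=> zp' x /zp' zx; have lt_x : (r x < m.+1)%N by rewrite ltnS rank_le_top.
  by exists (Ordinal lt_x).
apply: polygonal_cons; [exact: enum_of_flag|exact: ins|exact: ins|].
exact: polygonal_nil.
Qed.

End Points.


(** * The distributive sublattice generated by two flags *)

Section Apartment.
Context {disp : Order.disp_t} {L : tbLatticeType disp}.
Variable r : L -> nat.
Hypothesis rk : is_rank r.

Local Notation m := (r \top%O).
Local Notation flag := (flag r).
Local Notation step := (step r).

(** The matching [pi] of the Jordan-Hoelder theorem: as [j] grows, [e j] starts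
    to cross the [i]-th step of [c] exactly after [j = pi i], because steps are
    monotone in the element. *)
Lemma relative_position (c e : nat -> L) : flag c -> flag e ->
  exists pi : 'I_m -> nat, forall (i : 'I_m) j, step c i (e j) = (pi i < j)%N.
Proof.
move=> fc fe; have [home _] := fe.
suff /fin_all_exists : forall i : 'I_m, exists n, forall j,
  step c i (e j) = (n < j)%N by [].
move=> i.
have exj : exists j, step c i (e j).
  exists m; rewrite (flag_top rk fe) // step_flag ?ltn_ord //.
  by rewrite (flag_top rk fc).
have [j0 stj0 minj0] := ex_minnP exj.
case: j0 stj0 minj0 => [|j0] stj0 minj0.
  by move: stj0; rewrite (flag0 rk fe) (step_flag rk _ fc) rank0 // (flag0 rk fc).
exists j0 => j; apply/idP/idP => [/minj0//|le_j].
exact: step_le (home _ _ le_j) stj0.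
Qed.

Variables c e : nat -> L.
Hypotheses (fc : flag c) (fe : flag e).
Variable pi : 'I_m -> nat.
Hypothesis piP : forall (i : 'I_m) j, step c i (e j) = (pi i < j)%N.
Implicit Types U V : {set 'I_m}.

Definition box (i j : nat) : {set 'I_m} := [set k : 'I_m | (k < i)%N && (pi k < j)%N]%SET.

Lemma rank_box i j : (i <= m)%N -> r (c i `&` e j)%O = #|box i j|.
Proof.
move=> im; rewrite meetC (step_sum rk _ _ fc).
rewrite (big_ord_widen m (fun k => step c k (e j) : nat) im).
rewrite -sum1_card [RHS]big_mkcond [LHS]big_mkcond; apply: eq_bigr => k _.
by rewrite inE piP; case: (k < i)%N; case: (pi k < j)%N.
Qed.

(** The index [i] stands for the cell in row [i] and column [pi i] of the grid
    of the meets [c i /\ e j]. Sets of cells are taken closed in the order of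
    the grid, so that [sigma] below loses no information. *)
Definition downset U : Prop :=
  forall k i : 'I_m, i \in U -> (k <= i)%N -> (pi k <= pi i)%N -> k \in U.

Definition sigma U : L := (\join_(i in U) (c i.+1 `&` e (pi i).+1))%O.

Lemma downset_box i j : downset (box i j).
Proof.
move=> k l; rewrite !inE => /andP[li lj] kl pkl.
by rewrite (leq_ltn_trans kl) // (leq_ltn_trans pkl).
Qed.

Lemma downsetU U V : downset U -> downset V -> downset (U :|: V).
Proof.
move=> dU dV k i; rewrite !inE => /orP[iU|iV] ki pki.
  by rewrite (dU k i).
by rewrite (dV k i) ?orbT.
Qed.

Lemma downsetI U V : downset U -> downset V -> downset (U :&: V).
Proof.
move=> dU dV k i; rewrite !inE => /andP[iU iV] ki pki.
by rewrite (dU k i) // (dV k i).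
Qed.

Lemma sigma_sub U V : U \subset V -> (sigma U <= sigma V)%O.
Proof. exact: le_joins. Qed.

Lemma sigmaU U V : sigma (U :|: V) = (sigma U `|` sigma V)%O.
Proof. exact: joins_setU. Qed.

Lemma sigma_box_le i j : (sigma (box i j) <= c i `&` e j)%O.
Proof.
apply/joinsP => k; rewrite inE => /andP[ki pkj].
by rewrite leI2 //; [apply: (proj1 fc)|apply: (proj1 fe)].
Qed.

(** Remove the cell [i] of the last row. What remains lies below [c i], so it
    meets the removed generator in [c i /\ e (pi i).+1], an element that the
    remaining cells already generate; hence each cell adds exactly one. *)
Lemma rank_sigma U : downset U -> r (sigma U) = #|U|.
Proof.
move=> dU; suff h n : (n <= m)%N -> forall V, downset V ->
    (forall i, i \in V -> (i < n)%N) -> r (sigma V) = #|V|.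
  exact: (h m).
elim: n {U dU} => [|n IHn] nm U dU Un.
  have -> : U = finset.set0 by apply/finset.setP => i; rewrite inE; apply/negP => /Un.
  by rewrite /sigma big_set0 cards0 (rank0 rk).
pose i := Ordinal nm.
have [iU|niU] := boolP (i \in U); last first.
  apply: (IHn (ltnW nm)) => // j jU.
  have := Un j jU; rewrite ltnS leq_eqVlt => /orP[/eqP ji|//].
  by case/negP: niU; rewrite (_ : i = j) //; apply: val_inj.
pose U' := U :\ i.
have lt_i j : j \in U' -> (j < i)%N.
  rewrite !inE => /andP[ji jU]; have := Un j jU.
  rewrite ltnS leq_eqVlt => /orP[/eqP e_ji|//].
  by case/eqP: ji; apply: val_inj.
have dU' : downset U'.
  move=> k j jU' kj pkj; have ltj := lt_i _ jU'; move: jU'.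
  rewrite !inE => /andP[_ jU]; rewrite (dU k j) // andbT.
  by apply: contraTneq ltj => <-; rewrite -leqNgt.
have rU' : r (sigma U') = #|U'| by apply: (IHn (ltnW nm)).
(* Both sides have the rank [#|box i (pi i).+1|]: the left one by induction, as
   the box lies in earlier rows, the right one by counting steps. *)
have boxE : sigma (box i (pi i).+1) = (c i `&` e (pi i).+1)%O.
  apply: (rank_le_eq rk (sigma_box_le _ _)).
  rewrite rank_box ?(ltnW (ltn_ord i)) // (IHn (ltnW nm)) //.
    exact: downset_box.
  by move=> j; rewrite inE => /andP[].
have box_sub : box i (pi i).+1 \subset U'.
  apply/fintype.subsetP => j; rewrite !inE => /andP[ji pji].
  rewrite (dU j i iU (ltnW ji) pji) andbT.
  by apply: contraTneq ji => ->; rewrite ltnn.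
have meetE : ((c i.+1 `&` e (pi i).+1) `&` sigma U' = c i `&` e (pi i).+1)%O.
  apply/le_anti/andP; split.
    rewrite lexI; apply/andP; split.
      apply: le_trans (leIr _ _) _; apply/joinsP => j /lt_i ji.
      by rewrite (le_trans (leIl _ _)) //; apply: (proj1 fc).
    by rewrite (le_trans (leIl _ _)) // leIr.
  rewrite lexI -{2}boxE sigma_sub // andbT leI2 //.
  by apply: (proj1 fc).
have sE : sigma U = ((c i.+1 `&` e (pi i).+1) `|` sigma U')%O.
  by rewrite /sigma (big_setD1 i).
have := rank_modular rk (c i.+1 `&` e (pi i).+1)%O (sigma U').
rewrite meetE -sE [(c i.+1 `&` _)%O]meetC (step_rank rk _ _ fc) piP ltnSn.
rewrite [(e _ `&` _)%O]meetC rU' (cardsD1 i U) iU -/U' -addnA.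
by move=> /addnI.
Qed.

(** The sublattice generated by two chains is distributive. As ranks are
    cardinals on downsets, inclusion-exclusion for sets and modularity of the
    rank give both sides the same rank. *)
Lemma sigmaI U V : downset U -> downset V ->
  sigma (U :&: V) = (sigma U `&` sigma V)%O.
Proof.
move=> dU dV; apply: (rank_le_eq rk).
  by rewrite lexI !sigma_sub ?finset.subsetIl ?finset.subsetIr.
have := rank_modular rk (sigma U) (sigma V).
rewrite -sigmaU !rank_sigma //; [|exact: downsetI|exact: downsetU].
by have := cardsUI U V; lia.
Qed.

Lemma sigma_rows i : (i <= m)%N -> sigma [set k : 'I_m | (k < i)%N]%SET = c i.
Proof.
move=> im; have -> : [set k : 'I_m | (k < i)%N]%SET = box i m.
  apply/finset.setP => k; rewrite !inE -piP (flag_top rk fe) // step_flag ?ltn_ord ?andbT //.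
  exact: flag_top fc _.
apply: (rank_le_eq rk).
  exact: le_trans (sigma_box_le _ _) (leIl _ _).
rewrite rank_sigma; last exact: downset_box.
by rewrite -rank_box // (flag_top rk fe) // meetx1.
Qed.

Lemma sigma_cols j : sigma [set k : 'I_m | (pi k < j)%N]%SET = e j.
Proof.
have -> : [set k : 'I_m | (pi k < j)%N]%SET = box m j.
  by apply/finset.setP => k; rewrite !inE ltn_ord.
apply: (rank_le_eq rk).
  exact: le_trans (sigma_box_le _ _) (leIr _ _).
rewrite rank_sigma; last exact: downset_box.
by rewrite -rank_box // (flag_top rk fc) // meet1x.
Qed.

(** Linear extensions of the order of the grid: they give the flags, hence the
    simplices, of the apartment. *)
Definition admissible (s : seq 'I_m) : Prop :=
  [/\ uniq s, size s = m & forall k, downset [set i in take k s]%SET].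

Definition seq_flag (s : seq 'I_m) (k : nat) : L := sigma [set i in take k s]%SET.

Lemma mem_admissible s x : admissible s -> x \in s.
Proof.
move=> [us ss _]; have sub : {subset s <= enum 'I_m}.
  by move=> y _; rewrite mem_enum.
have [|_ ->] := uniq_min_size us sub; last by rewrite mem_enum.
by rewrite size_enum_ord ss.
Qed.

Lemma card_take s k : admissible s -> #|[set i in take k s]%SET| = minn k m.
Proof.
move=> [us ss _]; rewrite cardsE; have /card_uniqP-> := take_uniq k us.
by rewrite size_take_min ss.
Qed.

Lemma flag_seq_flag s : admissible s -> flag (seq_flag s).
Proof.
move=> As; have [us ss ds] := As; split=> [i j ij|k].
  apply: sigma_sub; apply/fintype.subsetP => x; rewrite !inE.
  by rewrite -(take_takel _ ij); apply: mem_take.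
by rewrite rank_sigma // card_take.
Qed.

(** In the flag of [s] the [k]-th step is the cell [nth i0 s k] alone, whence
    the indicator vector of [U] as coordinates of [sigma U]. *)
Lemma step_sigma s (k : 'I_m) i0 U : admissible s -> downset U ->
  step (seq_flag s) k (sigma U) = (nth i0 s k \in U).
Proof.
move=> As dU; have [us ss ds] := As; rewrite /step /seq_flag -!sigmaI //.
rewrite !rank_sigma; try exact: downsetI.
have km : (k < size s)%N by rewrite ss.
have -> : [set i in take k.+1 s]%SET = nth i0 s k |: [set i in take k s]%SET.
  by apply/finset.setP => x; rewrite !inE (take_nth i0) // mem_rcons inE.
rewrite finset.setIUr; have [sU|sU] := boolP (nth i0 s k \in U).
  have -> : U :&: [set nth i0 s k]%SET = [set nth i0 s k]%SET.
    by apply/finset.setIidPr; rewrite finset.sub1set.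
  rewrite cardsU1 !inE sU /= in_take_leq ?index_uniq ?ltnn ?add1n ?leqnn //.
  exact: ltnW.
rewrite (_ : U :&: [set nth i0 s k]%SET = finset.set0) ?finset.set0U ?ltnn //.
apply/finset.setP => x; rewrite !inE; apply/negP => /andP[xU /eqP e_x].
by rewrite e_x (negPf sU) in xU.
Qed.

End Apartment.

(** * The geometry of an apartment *)

Section ApartmentPoints.
Context {R : realType} {disp : Order.disp_t} {L : tbLatticeType disp}.
Variable r : L -> nat.
Hypothesis rk : is_rank r.
Hypothesis Lgr : graded L.

Local Notation m := (r \top%O).
Local Notation flag := (flag r).

Variables c e : nat -> L.
Hypotheses (fc : flag c) (fe : flag e).
Variable pi : 'I_m -> nat.
Hypothesis piP : forall (i : 'I_m) j, step r c i (e j) = (pi i < j)%N.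
Implicit Types (U V : {set 'I_m}) (h a b : 'I_m -> R) (s : seq 'I_m).
Implicit Types p q : orthoscheme R L.

Local Notation downset := (downset pi).
Local Notation sigma := (sigma c e pi).
Local Notation admissible := (admissible pi).
Local Notation seq_flag := (seq_flag c e pi).

Definition upper_level h U : Prop :=
  forall x y, x \in U -> y \notin U -> h y < h x.

Definition apt_vector h : Prop :=
  (forall i, 0 <= h i <= 1) /\
  forall k i : 'I_m, (k <= i)%N -> (pi k <= pi i)%N -> h i <= h k.

(** The order polytope of the cells parametrises the part of the complex that
    is spanned by [c] and [e]: the vector [h] stands for the point whose weight
    on [sigma U], for [U] a level set of [h], is the drop of [h] at [U]. *)
Record represents h p : Prop := Represents {
  rep_vector : apt_vector h;
  rep_support : forall x, p x != 0 ->
    exists2 U, downset U /\ upper_level h U & x = sigma U;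
  rep_coord : forall s, admissible s -> forall k : 'I_m,
    coord r (seq_flag s) p k = h (nth k s k)
}.

Definition adapted h s : Prop :=
  forall k x y, x \in take k s -> y \notin take k s -> h y <= h x.

(** Sort the cells by decreasing value of [h]; ties are broken by the row index,
    which is compatible with the order of the grid. *)
Lemma adapted_exists h : apt_vector h -> exists2 s, admissible s & adapted h s.
Proof.
move=> [_ hmono].
pose le x y := (h y < h x) || (h x == h y) && (x <= y)%N.
have le_total : total le.
  by move=> x y; rewrite /le; case: ltgtP => //= _; exact: leq_total.
have le_trans : transitive le.
  move=> y x t; rewrite /le => /orP[xy|/andP[/eqP exy xy]] /orP[yt|/andP[/eqP eyt yt]].
  - by rewrite (lt_trans yt xy).
  - by rewrite -eyt xy.
  - by rewrite exy yt.
  - by rewrite exy eyt eqxx (leq_trans xy yt) orbT.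
have le_refl : reflexive le by move=> x; rewrite /le eqxx leqnn orbT.
pose s := sort le (enum 'I_m).
have ms x : x \in s by rewrite mem_sort mem_enum.
have ord k x y : x \in take k s -> y \notin take k s -> le x y.
  rewrite !in_take // -leqNgt => xk ky.
  rewrite -(nth_index x (ms x)) -(nth_index x (ms y)).
  apply: (sorted_leq_nth le_trans le_refl x (sort_sorted le_total _));
    rewrite ?inE ?index_mem ?ms //.
  exact: ltnW (leq_trans xk ky).
exists s; last first.
  by move=> k x y xk yk; have /orP[/ltW//|/andP[/eqP->]] := ord k x y xk yk.
split; rewrite ?sort_uniq ?enum_uniq ?size_sort ?size_enum_ord // => k x y.
rewrite !inE => yk xy pxy; apply: contraT => xk.
have := ord k y x yk xk; rewrite /le ltNge hmono //= => /andP[_ yx].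
by case/negP: xk; rewrite (_ : x = y) //; apply/val_inj/anti_leq; rewrite xy.
Qed.

(** A level set of [h] is an initial segment of any order that sorts [h]. *)
Lemma upper_level_prefix h s U : admissible s -> adapted h s ->
  upper_level h U -> U = [set i in take #|U| s]%SET.
Proof.
move=> As hs hU; have cardT := card_take #|U| As.
have leU : (#|U| <= m)%N by rewrite -[X in (_ <= X)%N](card_ord m) max_card.
rewrite (minn_idPl leU) in cardT.
apply/eqP; rewrite eqEcard cardT leqnn andbT; apply/fintype.subsetP => x xU.
apply: contraT => xT.
have /fintype.subsetPn[y] : ~~ ([set i in take #|U| s]%SET \subset U :\ x).
  apply/negP => /subset_leq_card; rewrite cardT [X in (X <= _)%N](cardsD1 x U) xU.
    by rewrite add1n ltnn.
rewrite inE in xT; rewrite !inE => yT.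
rewrite negb_and negbK => /orP[/eqP yx|yU]; first by rewrite -yx yT in xT.
by have := hU _ _ xU yU; rewrite ltNge (hs _ _ _ yT xT).
Qed.

Lemma rep_through h p s : represents h p -> admissible s -> adapted h s ->
  through r (seq_flag s) p.
Proof.
move=> hp As hs x /(rep_support hp)[U [dU hU] ->].
by rewrite (rank_sigma rk fc fe piP dU) /seq_flag -(upper_level_prefix As hs hU).
Qed.

(** Two sorting orders of the same [h] may differ, but a simplex that contains
    both points exists and their coordinates agree in it. *)
Lemma rep_inj h p q : represents h p -> represents h q -> p = q.
Proof.
move=> hp hq; have [s As hs] := adapted_exists (rep_vector hp).
apply: (coord_inj rk Lgr (flag_seq_flag rk fc fe piP As)).
- exact: rep_through hp As hs.
- exact: rep_through hq As hs.
- by move=> k km; have := rep_coord hp As (Ordinal km) => /= ->;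
     rewrite (rep_coord hq As (Ordinal km)).
Qed.

Lemma sum_admissible s (F : 'I_m -> R) : admissible s ->
  \sum_(k < m) F (nth k s k) = \sum_(i < m) F i.
Proof.
move=> As; have [us ss _] := As.
have ps : perm_eq s (enum 'I_m).
    by apply: uniq_perm; rewrite ?enum_uniq // => x; rewrite mem_enum (mem_admissible x As).
rewrite -[RHS]big_enum -(perm_big _ ps) /=.
case: (posnP m) => [m0|m0].
  rewrite (size0nil (_ : size s = 0%N)) ?ss // big_nil big1 // => k _.
  by have := ltn_ord k; rewrite {2}m0.
rewrite [RHS](big_nth (Ordinal m0)) ss big_mkord; apply: eq_bigr => k _.
by rewrite (set_nth_default (Ordinal m0)) // ss.
Qed.

(** The parametrisation of the apartment is isometric: retract along a simplex
    through [p], and reorder the coordinates. *)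
Lemma rep_dist2 h h' p q : represents h p -> represents h' q ->
  dist2 r p q = \sum_(i < m) (h i - h' i) ^+ 2.
Proof.
move=> hp hq; have [s As hs] := adapted_exists (rep_vector hp).
rewrite (dist2_eq rk Lgr _ (flag_seq_flag rk fc fe piP As) (rep_through hp As hs)).
rewrite -(sum_admissible (fun i => (h i - h' i) ^+ 2) As).
by apply: eq_bigr => k _; rewrite (rep_coord hp) // (rep_coord hq).
Qed.

(** Both flags, and every flag of the apartment, are images under [sigma] of a
    growing family of downsets. *)
Lemma represents_family (f : nat -> L) (V : nat -> {set 'I_m}) p :
  flag f -> (forall i, downset (V i)) -> (forall i j, (i <= j)%N -> V i \subset V j) ->
  (forall i, (i <= m)%N -> f i = sigma (V i)) -> through r f p ->
  represents (fun k => \sum_(i < m.+1) p (f i) * (k \in V i)%:R) p.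
Proof.
move=> ff dV sV fV fp.
have mass : \sum_(i < m.+1) p (f i) = 1.
  rewrite -[RHS](expect_cst rk Lgr p) (expect_flag rk _ ff fp).
  by apply: eq_bigr => i _; rewrite mulr1.
split.
- split=> [k|k i ki pki].
    rewrite sumr_ge0 => [|i _]; last by rewrite mulr_ge0 ?bary_ge0 ?ler0n.
    rewrite -[leRHS]mass ler_sum // => i _.
    by apply: ler_piMr; rewrite ?bary_ge0 // lern1 leq_b1.
  apply: ler_sum => j _; rewrite ler_wpM2l ?bary_ge0 // ler_nat.
  by case: (boolP (i \in _)) => // /dV ->.
- move=> x px; have xm := rank_le_top rk x; exists (V (r x)); last first.
    by rewrite -fV // fp.
  split=> // y t yV tV.
  have lt_x : (r x < m.+1)%N by rewrite ltnS.
  rewrite (bigD1 (Ordinal lt_x)) //= [ltRHS](bigD1 (Ordinal lt_x)) //=.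
  rewrite (negPf tV) yV mulr0 mulr1; apply: ltr_leD.
    by rewrite fp // lt_neqAle eq_sym px bary_ge0.
  apply: ler_sum => j _; rewrite ler_wpM2l ?bary_ge0 // ler_nat.
  case: (boolP (t \in _)) => // tj; have [jx|xj] := leqP j (r x).
    by case/negP: tV; apply: (fintype.subsetP (sV _ _ jx)).
  by rewrite (fintype.subsetP (sV _ _ (ltnW xj))).
- move=> s As k; rewrite /coord (expect_flag rk _ ff fp); apply: eq_bigr => i _.
  rewrite fV; last by rewrite -ltnS ltn_ord.
  by rewrite (step_sigma rk fc fe piP k k As).
Qed.

Lemma represents_exists h : apt_vector h -> exists p, represents h p.
Proof.
move=> hv; have [s As hs] := adapted_exists hv; have [us ss ds] := As.
have ff := flag_seq_flag rk fc fe piP As.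
(* The sorted values of [h], between the values 1 before the first cell and 0
   (the default) after the last one; their drops are the weights. *)
pose H k := nth 0 (1 :: map h s) k.
have Hm : H m.+1 = 0 by rewrite /H nth_default //= size_map ss.
have HS (i0 : 'I_m) k : (k < m)%N -> H k.+1 = h (nth i0 s k).
  by move=> km; rewrite /H /= (nth_map i0) ?ss.
have [h01 _] := hv.
have H0 k : 0 <= H k.
  case: k => [|k]; first exact: ler01.
  have [km|mk] := ltnP k m; last by rewrite /H /= nth_default // size_map ss.
  by rewrite (HS (Ordinal km)) //; have /andP[] := h01 (nth (Ordinal km) s k).
have Hdecr k : 0 <= H k - H k.+1.
  rewrite subr_ge0; have [km|mk] := ltnP k m; last first.
    by rewrite {1}/H /= nth_default // size_map ss.
  rewrite (HS (Ordinal km)) //; case: k km => [|k] km.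
    by have /andP[] := h01 (nth (Ordinal km) s 0).
  rewrite (HS (Ordinal km)); last exact: ltnW.
  apply: (hs k.+1).
    by rewrite (take_nth (Ordinal km)) ?mem_rcons ?inE ?eqxx // ss ltnW.
  by rewrite in_take_leq ?ss ?index_uniq ?ss ?ltnn // ltnW.
have Hsum j : (j <= m)%N -> \sum_(j <= k < m.+1) (H k - H k.+1) = H j.
  move=> jm; under eq_bigr => k _ do rewrite -opprB.
  by rewrite sumrN telescope_sumr ?Hm ?sub0r ?opprK // leqW.
have [|p zp pE] := ex_point rk ff Hdecr.
  by rewrite -(big_mkord xpredT (fun k => H k - H k.+1)) Hsum.
exists p.
suff -> : h = (fun x => \sum_(i < m.+1) p (seq_flag s i) * (x \in [set j in take i s]%SET)%:R).
  apply: (@represents_family _ (fun k => [set j in take k s]%SET) p ff) => // i j ij.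
  apply/fintype.subsetP => x; rewrite !inE -(take_takel _ ij); exact: mem_take.
apply/funext => x.
have xs : x \in s := mem_admissible x As.
have jm : (index x s < m)%N by move: xs; rewrite -index_mem ss.
have -> : h x = H (index x s).+1 by rewrite (HS x) // nth_index.
rewrite -Hsum // (big_nat_widenl _ 0%N) // big_mkord big_mkcond.
apply: eq_bigr => i _; rewrite pE; last by rewrite -ltnS ltn_ord.
by rewrite inE in_take //; case: (_ < _)%N; rewrite ?mulr1 ?mulr0.
Qed.

Lemma represents_rows p : through r c p -> exists h, represents h p.
Proof.
move=> cp; exists (fun k => \sum_(i < m.+1) p (c i) * (k \in [set j : 'I_m | (j < i)%N]%SET)%:R).
apply: (@represents_family _ (fun i => [set j : 'I_m | (j < i)%N]%SET) p fc) => // [i k j|i j ij|i im].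
- by rewrite !inE => ji kj _; exact: leq_ltn_trans ji.
- by apply/fintype.subsetP => k; rewrite !inE => /leq_trans; apply.
- by rewrite (sigma_rows rk fc fe piP).
Qed.

Lemma represents_cols p : through r e p -> exists h, represents h p.
Proof.
move=> ep; exists (fun k => \sum_(i < m.+1) p (e i) * (k \in [set j : 'I_m | (pi j < i)%N]%SET)%:R).
apply: (@represents_family _ (fun i => [set j : 'I_m | (pi j < i)%N]%SET) p fe) => // [i k j|i j ij|i im].
- by rewrite !inE => ji _ kj; exact: leq_ltn_trans ji.
- by apply/fintype.subsetP => k; rewrite !inE => /leq_trans; apply.
- by rewrite (sigma_cols rk fc fe piP).
Qed.

Definition mix (t : R) a b : 'I_m -> R := fun i => (1 - t) * a i + t * b i.

Lemma apt_vector_mix t a b : 0 <= t <= 1 -> apt_vector a -> apt_vector b ->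
  apt_vector (mix t a b).
Proof.
move=> /andP[t0 t1] [a01 am] [b01 bm]; rewrite /mix; split=> [i|k i ki pki].
  have /andP[a0 a1] := a01 i; have /andP[b0 b1] := b01 i.
  by apply/andP; split; nra.
have := am k i ki pki; have := bm k i ki pki; nra.
Qed.

(** The retraction centred at a flag through [g] keeps distances to [g], does
    not increase the others, and is isometric on the apartment; so the
    inequality is inherited from the Euclidean identity in the apartment. *)
Lemma rep_mix_CN t a b p q g f : 0 <= t <= 1 ->
  represents a p -> represents b q -> represents (mix t a b) g ->
  dist2 r f g <= (1 - t) * dist2 r f p + t * dist2 r f q
    - t * (1 - t) * dist2 r p q.
Proof.
move=> /andP[t0 t1] ap bq hg.
have [s As hs] := adapted_exists (rep_vector hg).
have fz := flag_seq_flag rk fc fe piP As; set z := seq_flag s in fz.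
have fg : dist2 r f g = \sum_(k < m) (coord r z f k - mix t a b (nth k s k)) ^+ 2.
  rewrite dist2_sym // (dist2_eq rk Lgr _ fz (rep_through hg As hs)).
  by apply: eq_bigr => k _; rewrite (rep_coord hg) //; ring.
have fp := dist2_ge rk Lgr f p fz; have fq := dist2_ge rk Lgr f q fz.
have pq := rep_dist2 ap bq.
rewrite -(sum_admissible (fun i => (a i - b i) ^+ 2) As) in pq.
have fp' := ler_wpM2l (_ : 0 <= 1 - t) fp; have fq' := ler_wpM2l t0 fq.
apply: le_trans (_ : _ <= (1 - t) * \sum_(k < m) (coord r z f k - coord r z p k) ^+ 2
  + t * \sum_(k < m) (coord r z f k - coord r z q k) ^+ 2
    - t * (1 - t) * dist2 r p q) _; last first.
  by rewrite lerD2r lerD // fp' // subr_ge0.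
rewrite fg pq !mulr_sumr -sumrN -!big_split /= le_eqVlt; apply/orP; left; apply/eqP.
apply: eq_bigr => k _; rewrite /z (rep_coord ap) // (rep_coord bq) // /mix; ring.
Qed.

Lemma polygonal_path_cat p q f l l' : polygonal_path p q l ->
  polygonal_path q f l' -> polygonal_path p f (l + l').
Proof.
elim=> [x|n c' x y t l0 cm cx cy _ IH] qf; first by rewrite add0r.
by rewrite -addrA; apply: polygonal_cons cm cx cy (IH qf).
Qed.

(** If no pair of coordinates is ordered in opposite ways by [a] and [b], the
    order that sorts their midpoint sorts both, and one simplex contains both
    points. In general [ps] lists the pairs that may be reversed; the segment is
    cut where the first of them becomes equal, after which neither half
    reverses it. *)
Lemma rep_polygonal (ps : seq ('I_m * 'I_m)) a b p q :
  represents a p -> represents b q ->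
  (forall x y, (x, y) \notin ps -> 0 <= (a x - a y) * (b x - b y)) ->
  polygonal_path p q (Num.sqrt (dist2 r p q)).
Proof.
elim: ps a b p q => [|[x y] ps IH] a b p q ap bq same.
  have half01 : 0 <= (2^-1 : R) <= 1 by lra.
  have hv := apt_vector_mix half01 (rep_vector ap) (rep_vector bq).
  have [s As hs] := adapted_exists hv.
  have fz := flag_seq_flag rk fc fe piP As.
  apply: (polygonal_path_flag rk Lgr fz).
    apply: (rep_through ap As) => k x y xk yk.
    have := hs k x y xk yk; have := same x y isT; rewrite /mix; nra.
  apply: (rep_through bq As) => k x y xk yk.
  have := hs k x y xk yk; have := same x y isT; rewrite /mix; nra.
have [nneg|neg] := lerP 0 ((a x - a y) * (b x - b y)).
  apply: (IH a b) => // x' y' ps'.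
  have [[-> ->]//|ne] := eqVneq (x', y') (x, y).
  by apply: same; rewrite inE negb_or ne.
(* [t] is the time at which the coordinates [x] and [y] of [mix t a b] agree. *)
pose u := a x - a y; pose v := b x - b y; pose t := u / (u - v).
have uv0 : u * v < 0 by [].
have uv : 0 < (u - v) ^+ 2 by have := sqr_ge0 u; have := sqr_ge0 v; nra.
have tE : t * (u - v) = u.
  by rewrite /t divfK //; apply: contraTneq uv => ->; rewrite expr0n ltxx.
have t01 : 0 <= t <= 1.
  have tuv : t * (u - v) ^+ 2 = u * (u - v) by rewrite expr2 mulrA tE.
  have := sqr_ge0 u; have := sqr_ge0 v => v2 u2; apply/andP; split.
    by rewrite -(pmulr_lge0 _ uv) tuv; nra.
  by rewrite -subr_ge0 -(pmulr_lge0 _ uv) mulrBl tuv; nra.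
have [g hg] := represents_exists (apt_vector_mix t01 (rep_vector ap) (rep_vector bq)).
have /andP[t0 t1] := t01.
have gxy : mix t a b x - mix t a b y = 0 by move: tE; rewrite /mix /u /v; nra.
have nxy x' y' : (x', y') \notin ps ->
    (x' = x /\ y' = y) \/ 0 <= (a x' - a y') * (b x' - b y').
  move=> ps'; have [[-> ->]|ne] := eqVneq (x', y') (x, y); first by left.
  by right; apply: same; rewrite inE negb_or ne.
have pg : polygonal_path p g (Num.sqrt (dist2 r p g)).
  apply: (IH a (mix t a b)) => // x' y' /nxy[[-> ->]|ge0].
    by rewrite gxy mulr0.
  by have := sqr_ge0 (a x' - a y'); rewrite /mix; nra.
have gq : polygonal_path g q (Num.sqrt (dist2 r g q)).
  apply: (IH (mix t a b) b) => // x' y' /nxy[[-> ->]|ge0].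
    by rewrite gxy mul0r.
  by have := sqr_ge0 (b x' - b y'); rewrite /mix; nra.
suff -> : Num.sqrt (dist2 r p q) =
    Num.sqrt (dist2 r p g) + Num.sqrt (dist2 r g q).
  exact: polygonal_path_cat pg gq.
have -> : dist2 r p g = t ^+ 2 * dist2 r p q.
  rewrite (rep_dist2 ap hg) (rep_dist2 ap bq) mulr_sumr.
  by apply: eq_bigr => i _; rewrite /mix; ring.
have -> : dist2 r g q = (1 - t) ^+ 2 * dist2 r p q.
  rewrite (rep_dist2 hg bq) (rep_dist2 ap bq) mulr_sumr.
  by apply: eq_bigr => i _; rewrite /mix; ring.
have sqrtM w : 0 <= w ->
    Num.sqrt (w ^+ 2 * dist2 r p q) = w * Num.sqrt (dist2 r p q).
  by move=> w0; rewrite sqrtrM ?sqr_ge0 // sqrtr_sqr ger0_norm.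
by rewrite !sqrtM ?subr_ge0 // -mulrDl addrC subrK mul1r.
Qed.

End ApartmentPoints.

Section Segments.
Context {R : realType} {disp : Order.disp_t} {L : tbLatticeType disp}.
Variable r : L -> nat.
Hypothesis rk : is_rank r.
Hypothesis Lgr : graded L.
Implicit Types p q f : orthoscheme R L.

(** The straight segment in an apartment containing both points. *)
Lemma segment_exists p q : exists g : R -> orthoscheme R L,
  [/\ g 0 = p, g 1 = q,
      forall s t, 0 <= s <= 1 -> 0 <= t <= 1 ->
        dist2 r (g s) (g t) = (s - t) ^+ 2 * dist2 r p q &
      forall f t, 0 <= t <= 1 -> dist2 r f (g t) <=
        (1 - t) * dist2 r f p + t * dist2 r f q - t * (1 - t) * dist2 r p q].
Proof.
have [c fc cp] := ex_flag_through rk Lgr p.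
have [e fe eq] := ex_flag_through rk Lgr q.
have [pi piP] := relative_position rk fc fe.
have [a ap] := represents_rows rk Lgr fc fe piP cp.
have [b bq] := represents_cols rk Lgr fc fe piP eq.
have /choice[g gP] (t : R) :
    exists g, 0 <= t <= 1 -> represents c e pi (mix t a b) g.
  have [t01|nt] := boolP (0 <= t <= 1); last by exists p => t01; case/negP: nt.
  have [g hg] := represents_exists rk Lgr fc fe piP
    (apt_vector_mix t01 (rep_vector ap) (rep_vector bq)).
  by exists g.
exists g; split.
- apply: (rep_inj rk Lgr fc fe piP (gP 0 _)); rewrite ?lexx ?ler01 //.
  suff -> : mix 0 a b = a by [].
  by apply/funext => i; rewrite /mix; ring.
- apply: (rep_inj rk Lgr fc fe piP (gP 1 _)); rewrite ?lexx ?ler01 //.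
  suff -> : mix 1 a b = b by [].
  by apply/funext => i; rewrite /mix; ring.
- move=> s t s01 t01; rewrite (rep_dist2 rk Lgr fc fe piP (gP s s01) (gP t t01)).
  rewrite (rep_dist2 rk Lgr fc fe piP ap bq) mulr_sumr; apply: eq_bigr => i _.
  by rewrite /mix; ring.
- by move=> f t t01; apply: (rep_mix_CN rk Lgr fc fe piP f t01 ap bq (gP t t01)).
Qed.

Lemma polygonal_path_exists p q : polygonal_path p q (Num.sqrt (dist2 r p q)).
Proof.
have [c fc cp] := ex_flag_through rk Lgr p.
have [e fe eq] := ex_flag_through rk Lgr q.
have [pi piP] := relative_position rk fc fe.
have [a ap] := represents_rows rk Lgr fc fe piP cp.
have [b bq] := represents_cols rk Lgr fc fe piP eq.
apply: (rep_polygonal rk Lgr fc fe piP (ps := enum {: 'I_(r \top%O) * 'I_(r \top%O)}) ap bq).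
by move=> x y; rewrite mem_enum.
Qed.

Lemma dist2_eq0 p q : dist2 r p q = 0 -> p = q.
Proof.
have [c fc cp] := ex_flag_through rk Lgr p.
have [e fe eq] := ex_flag_through rk Lgr q.
have [pi piP] := relative_position rk fc fe.
have [a ap] := represents_rows rk Lgr fc fe piP cp.
have [b bq] := represents_cols rk Lgr fc fe piP eq.
rewrite (rep_dist2 rk Lgr fc fe piP ap bq) => /psumr_eq0P ab0.
apply: (rep_inj rk Lgr fc fe piP ap); suff -> : a = b by [].
apply/funext => i; apply/eqP; rewrite -subr_eq0 -sqrf_eq0 ab0 // => j _.
exact: sqr_ge0.
Qed.

Local Notation d p q := (Num.sqrt (dist2 r p q)).

(** Apply the convexity of [dist2 f] along the segment from [p] to [q] at the
    point that divides it in the ratio of [d p f] to [d f q], and use only that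
    the value there is nonnegative. *)
Lemma sqrt_dist2_triangle p f q : d p q <= d p f + d f q.
Proof.
have dE p' q' : d p' q' ^+ 2 = dist2 r p' q' by rewrite sqr_sqrtr // dist2_ge0.
have [a0 b0 c0] : [/\ 0 <= d p f, 0 <= d f q & 0 <= d p q] by split; exact: sqrtr_ge0.
have [pf|a_neq0] := eqVneq (d p f) 0.
  have -> : p = f by apply: dist2_eq0; rewrite -dE pf expr0n.
  by rewrite lerDr sqrtr_ge0.
have [fq|b_neq0] := eqVneq (d f q) 0.
  have -> : f = q by apply: dist2_eq0; rewrite -dE fq expr0n.
  by rewrite lerDl sqrtr_ge0.
have [g [_ _ _ CN]] := segment_exists p q.
have a_gt0 : 0 < d p f by rewrite lt_neqAle eq_sym a_neq0.
have b_gt0 : 0 < d f q by rewrite lt_neqAle eq_sym b_neq0.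
have ab_gt0 := addr_gt0 a_gt0 b_gt0; set S := d p f + d f q in ab_gt0 *.
pose t := d p f / S.
have tS : t * S = d p f by rewrite divfK // gt_eqF.
have t01 : 0 <= t <= 1.
  by rewrite /t divr_ge0 ?(ltW ab_gt0) //= ler_pdivrMr // mul1r /S lerDl.
have h := le_trans (dist2_ge0 rk Lgr f (g t)) (CN f t t01).
rewrite (dist2_sym rk Lgr f p) -(dE p f) -(dE f q) -(dE p q) in h.
rewrite -[_ <= S]ler_sqr ?nnegrE ?(ltW ab_gt0) //.
have ab : 0 < d p f * d f q by exact: mulr_gt0.
rewrite -(ler_pM2l ab).
have uS : (1 - t) * S = d f q by rewrite mulrBl mul1r tS /S addrC addKr.
have := mulr_ge0 h (sqr_ge0 S).
have -> : ((1 - t) * d p f ^+ 2 + t * d f q ^+ 2 - t * (1 - t) * d p q ^+ 2) * S ^+ 2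
  = ((1 - t) * S) * d p f ^+ 2 * S + (t * S) * d f q ^+ 2 * S
    - (t * S) * ((1 - t) * S) * d p q ^+ 2 by ring.
rewrite tS uS subr_ge0 => /le_trans; apply.
by rewrite /S le_eqVlt; apply/orP; left; apply/eqP; ring.
Qed.

(** Each straight piece has the length predicted by [dist2], so the triangle
    inequality bounds the total length. *)
Lemma polygonal_path_ge p q l : polygonal_path p q l -> d p q <= l.
Proof.
elim=> [x|n c x y t l0 cm cx cy _ IH].
  by rewrite dist2_refl sqrtr0.
rewrite (simplex_dist_in_simplex rk Lgr cm cx cy).
by apply: le_trans (sqrt_dist2_triangle x y t) _; rewrite lerD2l.
Qed.

Lemma orthoscheme_distE p q : orthoscheme_dist p q = d p q.
Proof.
have pq := polygonal_path_exists p q; apply/le_anti/andP; split.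
  apply: ge_inf => //; exists 0 => l /polygonal_path_ge.
  by apply: le_trans; exact: sqrtr_ge0.
by apply: lb_le_inf; [exists (d p q)|move=> l /polygonal_path_ge].
Qed.

End Segments.

(** * From the CN inequality to CAT(0) *)

Section CNtoCAT0.
Context {R : realType} {X : Type}.
Variable d : X -> X -> R.
Hypothesis dM : is_metric d.

(** The inequality of Bruhat and Tits, in the form with an arbitrary point of
    the geodesic instead of its midpoint. *)
Definition CN_along (p q : X) (g : R -> X) : Prop :=
  forall f s, 0 <= s <= d p q ->
    d f (g s) ^+ 2 <= (1 - s / d p q) * d f p ^+ 2 + s / d p q * d f q ^+ 2
      - s / d p q * (1 - s / d p q) * d p q ^+ 2.

Hypothesis CN : forall p q, exists2 g, is_geodesic d p q g & CN_along p q g.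

(** If the inequality holds along one geodesic from [p] to [q], then applied to a
    point of another one it bounds the distance of corresponding points by 0. *)
Lemma CN_along_geodesic p q g : is_geodesic d p q g -> CN_along p q g.
Proof.
have [d_ge0 d_eq0 d_sym _] := dM.
move=> [g0 g1 gd] f s sD; have [g' _ CN'] := CN p q.
suff -> : g s = g' s by exact: CN'.
apply/d_eq0/eqP; rewrite -sqrf_eq0 eq_le sqr_ge0 andbT.
apply: le_trans (CN' (g s) s sD) _.
have /andP[s0 sle] := sD; have D0 := d_ge0 p q.
have -> : d (g s) p = s.
  by rewrite -{1}g0 gd ?lexx ?D0 // subr0 ger0_norm.
have -> : d (g s) q = d p q - s.
  by rewrite -{1}g1 gd ?lexx ?D0 // distrC ger0_norm ?subr_ge0.
have [D_eq0|D_neq0] := eqVneq (d p q) 0.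
  have -> : s = 0 by apply/le_anti; rewrite s0 -D_eq0 sle.
  by rewrite D_eq0 !mul0r !subr0 expr0n !mulr0 addr0.
have sE : s = s / d p q * d p q by rewrite divfK.
set t := s / d p q in sE *; rewrite sE.
by rewrite le_eqVlt; apply/orP; left; apply/eqP; ring.
Qed.

Lemma eucl_dist_sqr n (u v : 'rV[R]_n) :
  eucl_dist u v ^+ 2 = \sum_(k < n) (u ord0 k - v ord0 k) ^+ 2.
Proof. by rewrite sqr_sqrtr // sumr_ge0 // => k _; exact: sqr_ge0. Qed.

(** Stewart's theorem. *)
Lemma eucl_dist_segment n (u v w : 'rV[R]_n) t :
  eucl_dist u (v + t *: (w - v)) ^+ 2 =
  (1 - t) * eucl_dist u v ^+ 2 + t * eucl_dist u w ^+ 2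
    - t * (1 - t) * eucl_dist v w ^+ 2.
Proof.
rewrite !eucl_dist_sqr !mulr_sumr -sumrN -!big_split /=.
by apply: eq_bigr => k _; rewrite !mxE; ring.
Qed.

Lemma eucl_dist_sym n (u v : 'rV[R]_n) : eucl_dist u v = eucl_dist v u.
Proof. by congr Num.sqrt; apply: eq_bigr => k _; ring. Qed.

(** The comparison inequality follows by applying the CN inequality to the two
    sides in turn: first from a vertex, then from a point of the first side. *)
Lemma CN_CAT0 : CAT0 d.
Proof.
have [d_ge0 d_eq0 d_sym _] := dM.
split=> //; first by move=> p q; have [g gg _] := CN p q; exists g.
move=> v g w gg wd i j s t sD tD.
pose x' := comparison_point d v w i s; pose y' := comparison_point d v w j t.
have side01 (k : 'I_3) l : 0 <= l <= d (v k) (v (k + 1)) ->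
    0 <= l / d (v k) (v (k + 1)) <= 1.
  move=> /andP[l0 lD]; rewrite divr_ge0 //=.
  have [->|D0] := eqVneq (d (v k) (v (k + 1))) 0; first by rewrite invr0 mulr0 ler01.
  by rewrite ler_pdivrMr ?mul1r // lt_neqAle eq_sym D0 d_ge0.
have toV k : d (g i s) (v k) ^+ 2 <= eucl_dist x' (w k) ^+ 2.
  rewrite d_sym eucl_dist_sym eucl_dist_segment !wd.
  exact: CN_along_geodesic (gg i) (v k) s sD.
rewrite -ler_sqr ?nnegrE ?d_ge0 ?sqrtr_ge0 //.
rewrite -/x' -/y' [leRHS]eucl_dist_segment !wd.
apply: le_trans (CN_along_geodesic (gg j) (g i s) tD) _.
have /andP[t0 t1] := side01 j t tD.
by rewrite lerD2r lerD // ler_wpM2l ?subr_ge0.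
Qed.

End CNtoCAT0.

Theorem theorem5p6 (R : realType) (disp : Order.disp_t)
    (L : tbLatticeType disp) :
  graded L -> modular L -> complemented L ->
  CAT0 (@orthoscheme_dist R disp L).
Proof.
move=> Lgr Lmod _; have [r rk] := rank_exists Lgr Lmod.
have dE (p q : orthoscheme R L) :
    orthoscheme_dist p q = Num.sqrt (dist2 r p q) := orthoscheme_distE rk Lgr p q.
have dE2 (p q : orthoscheme R L) : orthoscheme_dist p q ^+ 2 = dist2 r p q.
  by rewrite dE sqr_sqrtr // dist2_ge0.
apply: CN_CAT0; first split.
- by move=> p q; rewrite dE sqrtr_ge0.
- move=> p q; split=> [pq|->]; last by rewrite dE dist2_refl sqrtr0.
  by apply: (dist2_eq0 rk Lgr); rewrite -dE2 pq expr0n.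
- by move=> p q; rewrite !dE (dist2_sym rk Lgr).
- by move=> p f q; rewrite !dE; exact: sqrt_dist2_triangle.
move=> p q; set D := orthoscheme_dist p q.
have D0 : 0 <= D by rewrite /D dE sqrtr_ge0.
have [g [g0 g1 gd gCN]] := segment_exists rk Lgr p q.
have D01 s : 0 <= s <= D -> 0 <= s / D <= 1.
  move=> /andP[s0 sD]; rewrite divr_ge0 //=.
  have [->|Dneq0] := eqVneq D 0; first by rewrite invr0 mulr0 ler01.
  by rewrite ler_pdivrMr ?mul1r // lt_neqAle eq_sym Dneq0.
exists (fun s => g (s / D)); last by move=> f s sD; rewrite !dE2; exact/gCN/D01.
split; rewrite -/D /=; first by rewrite mul0r.
  have [Deq0|Dneq0] := eqVneq D 0; last by rewrite divff.
  by rewrite Deq0 mul0r g0; apply: (dist2_eq0 rk Lgr); rewrite -dE2 -/D Deq0 expr0n.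
move=> s t sD tD; rewrite dE gd ?D01 // sqrtrM ?sqr_ge0 // sqrtr_sqr -dE -/D.
rewrite -mulrBl normrM [`|D^-1|]ger0_norm ?invr_ge0 //.
have [Deq0|Dneq0] := eqVneq D 0; last by rewrite divfK.
have z0 l : 0 <= l <= D -> l = 0 by rewrite Deq0 => h; apply/le_anti; rewrite andbC.
by rewrite (z0 s sD) (z0 t tD) subrr normr0 !mul0r.
Qed.
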